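(* Let $N_\alpha$ and $N_\beta$ be two regular spacelike ruled surfaces in $E_1^3$, parametrized by $\vec r_\alpha(s_\alpha,v_\alpha)=\vec\alpha(s_\alpha)+v_\alpha\vec q_\alpha(s_\alpha)$ and $\vec r_\beta(s_\beta,v_\beta)=\vec\beta(s_\beta)+v_\beta\vec q_\beta(s_\beta)$, where $\vec\alpha,\vec\beta$ are the striction curves with arc length parameters $s_\alpha,s_\beta$. Suppose that $N_\alpha$ and $N_\beta$ are developable. Then $N_\alpha$ and $N_\beta$ are spacelike similar ruled surfaces with variable transformation if and only if the striction curves $\vec\alpha$ and $\vec\beta$ are similar curves with variable transformation.
   Context: $E_1^3$ is $\mathbb{R}^3$ with the Lorentz metric $\langle x,y\rangle=-x_1y_1+x_2y_2+x_3y_3$. A ruled surface is parametrized with its striction curve as base curve, $\vec c(s)+v\,\vec q(s)$, where $s$ is arc length of $\vec c$, $\vec q$ is a unit vector, $\langle d\vec c,d\vec q\rangle=0$, $\langle d\vec q,d\vec q\rangle\ne0$. The central normal $\vec h$ is the unit surface normal along the striction curve (in the direction $\pm d\vec q$). The surface is spacelike if $\vec h$ is timelike (so $\vec q$ is spacelike). The surface is developable if its distribution parameter $\dfrac{\det(d\vec c,\vec q,d\vec q)}{\langle d\vec q,d\vec q\rangle}$ vanishes identically. Definition (similar ruled surfaces): two regular spacelike ruled surfaces $N_\alpha,N_\beta$, parametrized as in the claim, are called spacelike similar ruled surfaces with variable transformation $\lambda_\beta^\alpha$ if there exists a variable transformation $s_\alpha=\int\lambda_\beta^\alpha(s_\beta)\,ds_\beta$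 of the arc lengths such that $\vec q_\alpha(s_\alpha)=\vec q_\beta(s_\beta)$ for all corresponding values of the parameters under the transformation. Definition (similar curves): two regular curves parametrized by arc lengths $s_\alpha,s_\beta$ with unit tangents $\vec T_\alpha,\vec T_\beta$ are called similar curves with variable transformation $\lambda_\beta^\alpha$ if there exists a variable transformation $s_\alpha=\int\lambda_\beta^\alpha(s_\beta)\,ds_\beta$ of the arc lengths such that $\vec T_\alpha(s_\alpha)=\vec T_\beta(s_\beta)$ for all corresponding values of the parameters.
   Formalization: Adds the assumption that the sign of ⟨T,q⟩ (striction tangent against ruling) is the same on both surfaces; without it the claim fails, e.g. for q_α=q_β=(sinh s,cosh s,0), α=(cosh s,sinh s,0), β=−α. *)

(* Defs.v *)
From HB Require Import structures.
From mathcomp Require Import all_boot all_order all_algebra.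
From mathcomp Require Import all_classical all_reals all_analysis.

Set Implicit Arguments.
Unset Strict Implicit.
Unset Printing Implicit Defensive.

Import Order.TTheory GRing.Theory Num.Theory.
Import numFieldNormedType.Exports.

Local Open Scope classical_set_scope.
Local Open Scope ring_scope.

Definition lorentz (R : realType) (x y : 'rV[R]_3) : R :=
  - (x 0 0 * y 0 0) + x 0 1 * y 0 1 + x 0 2 * y 0 2.

Notation "''<' x , y '>_L'" := (lorentz x y)
  (at level 8, format "''<' x ,  y '>_L'") : ring_scope.

Definition timelike (R : realType) (x : 'rV[R]_3) : Prop := '<x, x>_L < 0.

Definition det3 (R : realType) (x y z : 'rV[R]_3) : R :=
  \det (\matrix_(i < 3) nth 0 [:: x; y; z] i).

Definition C1_on (R : realType) (V : normedModType R) (I : set R)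
    (f : R -> V) : Prop :=
  forall s, I s -> derivable f s 1 /\ {for s, continuous (derive1 f)}.

(* Functions on an interval are total functions on R whose values outside
   of the interval are irrelevant. The curve may be spacelike or timelike,
   hence the absolute value in the arc length condition. *)
Record arc_length_curve (R : realType) := ArcLengthCurve {
  curve_dom : set R;
  curve_fun : R -> 'rV[R]_3;
  curve_dom_itv : is_interval curve_dom;
  curve_dom_open : open curve_dom;
  curve_dom_neq0 : curve_dom !=set0;
  curve_C1 : C1_on curve_dom curve_fun;
  curve_arc_length : forall s, curve_dom s ->
    `| '<derive1 curve_fun s, derive1 curve_fun s>_L | = 1 }.

Definition tangent (R : realType) (c : arc_length_curve R) : R -> 'rV[R]_3 :=
  derive1 (curve_fun c).

(* No immersion condition is imposed along the striction curve: it would be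
   incompatible with developability, where the tangent of the striction curve
   is collinear with the ruling. *)
Record ruled_surface (R : realType) := RuledSurface {
  striction : arc_length_curve R;
  ruling : R -> 'rV[R]_3;
  ruling_C1 : C1_on (curve_dom striction) ruling;
  ruling_unit : forall s, curve_dom striction s ->
    `| '<ruling s, ruling s>_L | = 1;
  striction_orth : forall s, curve_dom striction s ->
    '<tangent striction s, derive1 ruling s>_L = 0;
  ruling_noncyl : forall s, curve_dom striction s ->
    '<derive1 ruling s, derive1 ruling s>_L != 0 }.

Definition ruled_param (R : realType) (N : ruled_surface R) (s v : R) :
    'rV[R]_3 :=
  curve_fun (striction N) s + v *: ruling N s.

Definition central_normal (R : realType) (N : ruled_surface R) (s : R) :
    'rV[R]_3 :=
  let dq := derive1 (ruling N) s in (Num.sqrt `| '<dq, dq>_L |)^-1 *: dq.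

Definition spacelike_surface (R : realType) (N : ruled_surface R) : Prop :=
  forall s, curve_dom (striction N) s -> timelike (central_normal N s).

Definition distribution_parameter (R : realType) (N : ruled_surface R)
    (s : R) : R :=
  let q := ruling N in
  det3 (tangent (striction N) s) (q s) (derive1 q s) /
    '<derive1 q s, derive1 q s>_L.

Definition developable (R : realType) (N : ruled_surface R) : Prop :=
  forall s, curve_dom (striction N) s -> distribution_parameter N s = 0.

(* phi maps s_b in J to s_a in I, with s_a = \int lam(s_b) ds_b, i.e. phi is
   a primitive of lam; lam does not vanish because the change of variable is
   invertible, with inverse factor lam^-1. *)
Definition variable_transformation (R : realType) (J I : set R)
    (lam phi : R -> R) : Prop :=
  [/\ set_bij J I phi,
      forall s, J s -> is_derive s 1 phi (lam s),
      forall s, J s -> {for s, continuous lam} &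
      forall s, J s -> lam s != 0].

Definition similar_curves_with (R : realType) (lam : R -> R)
    (a b : arc_length_curve R) : Prop :=
  exists phi, variable_transformation (curve_dom b) (curve_dom a) lam phi /\
    forall s, curve_dom b s -> tangent a (phi s) = tangent b s.

Definition similar_curves (R : realType) (a b : arc_length_curve R) : Prop :=
  exists lam, similar_curves_with lam a b.

Definition similar_ruled_with (R : realType) (lam : R -> R)
    (Na Nb : ruled_surface R) : Prop :=
  exists phi,
    variable_transformation (curve_dom (striction Nb))
      (curve_dom (striction Na)) lam phi /\
    forall s, curve_dom (striction Nb) s -> ruling Na (phi s) = ruling Nb s.

Definition spacelike_similar_ruled (R : realType) (Na Nb : ruled_surface R) :
    Prop :=
  [/\ spacelike_surface Na, spacelike_surface Nb &
      exists lam, similar_ruled_with lam Na Nb].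

(* On a developable spacelike surface the unit tangent of the striction curve
   is q or - q. The condition says that the same sign occurs on both surfaces,
   in particular when the rulings are directed along the tangents, q = T.
   Opposite signs must be excluded: if q_b = q_a and b = - a then the rulings
   agree but T_b = - T_a. *)
Definition co_oriented (R : realType) (Na Nb : ruled_surface R) : Prop :=
  forall s t, curve_dom (striction Na) s -> curve_dom (striction Nb) t ->
    0 < '<tangent (striction Na) s, ruling Na s>_L *
        '<tangent (striction Nb) t, ruling Nb t>_L.

(* Main.v *)
Require Import Defs.
From mathcomp Require Import all_boot all_order all_algebra.
From mathcomp Require Import all_classical all_reals all_analysis.
From mathcomp Require Import ring lra.

Set Implicit Arguments.
Unset Strict Implicit.
Unset Printing Implicit Defensive.

Import Order.TTheory GRing.Theory Num.Theory.
Import numFieldNormedType.Exports.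

Local Open Scope classical_set_scope.
Local Open Scope ring_scope.

(** On a developable spacelike surface the unit tangent [T] of the striction
curve is [q] or [- q], where [q] is the ruling. Indeed [T] and [q] are both
orthogonal to [dq]: [T] by the choice of the striction curve as base curve, [q]
because its length is constant. As the central normal is timelike, so is [dq],
and the Lorentz form is therefore positive definite on the plane orthogonal to
[dq]. Developability makes [T], [q], [dq] linearly dependent; as [dq] is
transverse to that plane, [T] and [q] are then collinear, and being unit vectors
of a Euclidean plane they differ only by the sign ['<T, q>_L]
([tangent_developable]).

The co-orientation hypothesis says that this sign is the same constant on the
two surfaces ([co_oriented_tangent]), so a change of parameter matches the
rulings if and only if it matches the tangents
([co_oriented_rulings_agreeP]): the very same change of parameter serves for
both notions of similarity. *)

(** * Lorentzian linear algebra *)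

Section LorentzAlgebra.
Context {R : realType}.
Implicit Types u v w x : 'rV[R]_3.

Lemma lorentzC u v : '<u, v>_L = '<v, u>_L.
Proof. by rewrite /lorentz; ring. Qed.

Lemma lorentzZl a u v : '<a *: u, v>_L = a * '<u, v>_L.
Proof. by rewrite /lorentz !mxE; ring. Qed.

Lemma lorentzBl u v w : '<u - v, w>_L = '<u, w>_L - '<v, w>_L.
Proof. by rewrite /lorentz !mxE; ring. Qed.

Lemma lorentz_norm_subZ a u v : '<u - a *: v, u - a *: v>_L =
  '<u, u>_L - 2 * (a * '<u, v>_L) + a ^+ 2 * '<v, v>_L.
Proof. by rewrite /lorentz !mxE; ring. Qed.

Lemma timelikeZ a x : timelike (a *: x) -> timelike x.
Proof.
rewrite /timelike lorentzZl lorentzC lorentzZl mulrA -expr2 => ax0.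
rewrite ltNge; apply: contraTN ax0 => x_ge0.
by rewrite -leNgt mulr_ge0 ?sqr_ge0.
Qed.

Lemma row3E u : u = \row_i nth 0 [:: u 0 0; u 0 1; u 0 2] i.
Proof.
by apply/rowP => -[[|[|[|//]]] i3]; rewrite mxE /=; congr (u _ _); exact: val_inj.
Qed.

Lemma det3E u v w :
  det3 u v w = u 0 0 * (v 0 1 * w 0 2 - v 0 2 * w 0 1)
             - u 0 1 * (v 0 0 * w 0 2 - v 0 2 * w 0 0)
             + u 0 2 * (v 0 0 * w 0 1 - v 0 1 * w 0 0).
Proof.
(* With explicit entries, the indices of the Laplace expansion compute. *)
rewrite [in LHS](row3E u) [in LHS](row3E v) [in LHS](row3E w).
move: (u 0 0) (u 0 1) (u 0 2) (v 0 0) (v 0 1) (v 0 2) (w 0 0) (w 0 1) (w 0 2).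
move=> u0 u1 u2 v0 v1 v2 w0 w1 w2.
rewrite /det3 (expand_det_row _ 0) !big_ord_recl big_ord0 /cofactor.
rewrite !(expand_det_row _ 0) !big_ord_recl !big_ord0 /cofactor !det_mx11.
by rewrite !mxE /= /bump /= !(addn0, add0n, add1n); ring.
Qed.

(** As [u] and [v] are orthogonal to [x], the Gram matrix of [u], [v], [x] is
block diagonal and the left-hand side is its determinant. The Gram matrix of the
canonical basis has determinant -1, whence the sign. *)
Lemma lorentz_gram u v x : '<u, x>_L = 0 -> '<v, x>_L = 0 ->
  ('<u, u>_L * '<v, v>_L - '<u, v>_L ^+ 2) * '<x, x>_L = - det3 u v x ^+ 2.
Proof.
move=> ux vx.
have -> : ('<u, u>_L * '<v, v>_L - '<u, v>_L ^+ 2) * '<x, x>_L =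
  - det3 u v x ^+ 2 + '<u, u>_L * '<v, x>_L ^+ 2
  + '<v, v>_L * '<u, x>_L ^+ 2 - 2 * '<u, v>_L * '<u, x>_L * '<v, x>_L.
  rewrite det3E /lorentz.
  move: (u 0 0) (u 0 1) (u 0 2) (v 0 0) (v 0 1) (v 0 2) (x 0 0) (x 0 1) (x 0 2).
  by move=> u0 u1 u2 v0 v1 v2 x0 x1 x2; ring.
by rewrite ux vx; ring.
Qed.

(** Lagrange's identity behind the positivity of the form on the orthogonal
complement of a timelike vector. *)
Lemma lorentz_orthogonalE x w : '<w, x>_L = 0 ->
  x 0 0 ^+ 2 * '<w, w>_L = - '<x, x>_L * (w 0 1 ^+ 2 + w 0 2 ^+ 2)
                         + (w 0 1 * x 0 2 - w 0 2 * x 0 1) ^+ 2.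
Proof.
move=> wx.
have wx0 : w 0 0 * x 0 0 = w 0 1 * x 0 1 + w 0 2 * x 0 2.
  by move: wx; rewrite /lorentz; lra.
have -> : x 0 0 ^+ 2 * '<w, w>_L =
  - (w 0 0 * x 0 0) ^+ 2 + x 0 0 ^+ 2 * (w 0 1 ^+ 2 + w 0 2 ^+ 2).
  by rewrite /lorentz; ring.
by rewrite wx0 /lorentz; ring.
Qed.

Lemma timelike_time_gt0 x : timelike x -> 0 < x 0 0 ^+ 2.
Proof.
rewrite /timelike /lorentz => xx.
by have := sqr_ge0 (x 0 1); have := sqr_ge0 (x 0 2); lra.
Qed.

Lemma timelike_orthogonal_ge0 x w :
  timelike x -> '<w, x>_L = 0 -> 0 <= '<w, w>_L.
Proof.
move=> xt wx; rewrite -(pmulr_rge0 _ (timelike_time_gt0 xt)).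
rewrite lorentz_orthogonalE// addr_ge0 ?sqr_ge0// mulr_ge0//.
  by rewrite oppr_ge0 ltW.
by rewrite addr_ge0 ?sqr_ge0.
Qed.

Lemma timelike_orthogonal_eq0 x w :
  timelike x -> '<w, x>_L = 0 -> '<w, w>_L = 0 -> w = 0.
Proof.
move=> xt wx ww.
have xx : 0 < - '<x, x>_L by rewrite oppr_gt0.
have x00 : x 0 0 != 0 by rewrite -sqrf_eq0 gt_eqF// timelike_time_gt0.
have /esym/eqP := lorentz_orthogonalE wx.
have w12 : 0 <= w 0 1 ^+ 2 + w 0 2 ^+ 2 by rewrite addr_ge0 ?sqr_ge0.
rewrite ww mulr0 paddr_eq0 ?sqr_ge0 ?mulr_ge0 ?(ltW xx)//.
rewrite mulf_eq0 (gt_eqF xx)/= paddr_eq0 ?sqr_ge0// !sqrf_eq0.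
move=> /andP[/andP[/eqP w1 /eqP w2] _].
have /eqP : w 0 0 * x 0 0 = 0 by move: wx; rewrite /lorentz w1 w2; lra.
rewrite mulf_eq0 (negbTE x00) orbF => /eqP w0.
by rewrite (row3E w) w0 w1 w2; apply/rowP => -[[|[|[|//]]] i3]; rewrite !mxE.
Qed.

(** Equality case of Cauchy-Schwarz in the Euclidean plane orthogonal to [x].
The vanishing determinant is the equality condition: a relation between [u],
[v] and [x] cannot involve [x], which is orthogonal to [u] and [v] but not to
itself. *)
Lemma unit_orthogonal_collinear u v x : timelike x ->
  '<u, x>_L = 0 -> '<v, x>_L = 0 -> det3 u v x = 0 ->
  `|'<u, u>_L| = 1 -> `|'<v, v>_L| = 1 ->
  u = '<u, v>_L *: v /\ '<u, v>_L ^+ 2 = 1.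
Proof.
move=> xt ux vx uvx0.
rewrite !ger0_norm; [|exact: timelike_orthogonal_ge0 vx..
                     |exact: timelike_orthogonal_ge0 ux] => // uu vv.
have uv2 : '<u, v>_L ^+ 2 = 1.
  have /eqP := lorentz_gram ux vx.
  rewrite uvx0 expr0n oppr0 uu vv mulr1 mulf_eq0 (lt_eqF xt) orbF.
  by rewrite subr_eq0 => /eqP.
split => //; apply/eqP; rewrite -subr_eq0; apply/eqP.
apply: (timelike_orthogonal_eq0 xt); first by rewrite lorentzBl lorentzZl ux vx; ring.
by rewrite lorentz_norm_subZ uu vv -expr2 uv2; ring.
Qed.

End LorentzAlgebra.

(** * Tangent and ruling of a developable surface *)

Section UnitVectorFields.
Context {R : realType}.

Lemma is_derive_lorentz_self (f : R -> 'rV[R]_3) s : derivable f s 1 ->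
  is_derive s 1 (fun t => '<f t, f t>_L) (2 * '<f s, derive1 f s>_L).
Proof.
move=> fs.
have fij j : is_derive s 1 (fun t => f t 0 j) (derive1 f s 0 j).
  rewrite derive1E derive_mx// mxE; apply/derivableP.
  by move/derivable_mxP : fs; exact.
have dsqr j := is_deriveM (fij j) (fij j).
have dqf := is_deriveD (is_deriveD (is_deriveN (dsqr 0)) (dsqr 1)) (dsqr 2).
apply: (is_derive_eq dqf); rewrite /lorentz /GRing.scale/=.
move: (f s 0 0) (f s 0 1) (f s 0 2) => f0 f1 f2.
move: (derive1 f s 0 0) (derive1 f s 0 1) (derive1 f s 0 2) => d0 d1 d2.
by ring.
Qed.

(** The square of ['<f, f>_L] is the constant 1, so its derivative
[2 * '<f, f>_L * ('<f, f>_L)'] vanishes, while ['<f, f>_L] does not. *)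
Lemma unit_field_derive_orthogonal (I : set R) (f : R -> 'rV[R]_3) s :
  open I -> I s -> (forall t, I t -> `|'<f t, f t>_L| = 1) ->
  derivable f s 1 -> '<f s, derive1 f s>_L = 0.
Proof.
move=> oI Is f1 fs.
set g := fun t => '<f t, f t>_L.
have g2 t : I t -> g t ^+ 2 = 1.
  by move=> It; rewrite -real_normK ?num_real// f1// expr1n.
have dg := is_derive_lorentz_self fs.
have : is_derive s 1 (g ^+ 2) 0.
  have := @is_derive_cst R R R 1 s 1.
  apply: near_eq_is_derive.
  near=> t; rewrite -(g2 t)//; near: t; exact: open_nbhs_nbhs.
have := is_deriveX 2 dg => -[_ d1] [_]; rewrite d1 => /eqP.
have gs : g s != 0.
  by apply/eqP => gs0; have /eqP := g2 s Is; rewrite gs0 expr0n eq_sym oner_eq0.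
rewrite /GRing.scale/= !mulf_eq0 expr1 (negbTE gs) pnatr_eq0/= => /eqP//.
Unshelve. all: by end_near. Qed.

End UnitVectorFields.

Section Developable.
Context {R : realType}.

Lemma spacelike_dq_timelike (N : ruled_surface R) s : spacelike_surface N ->
  curve_dom (striction N) s -> timelike (derive1 (ruling N) s).
Proof. by move=> sN /sN; exact: timelikeZ. Qed.

Lemma developable_det3 (N : ruled_surface R) s : developable N ->
  curve_dom (striction N) s ->
  det3 (tangent (striction N) s) (ruling N s) (derive1 (ruling N) s) = 0.
Proof.
move=> dN Ns; have /eqP := dN s Ns; rewrite /distribution_parameter.
by rewrite mulf_eq0 invr_eq0 (negbTE (ruling_noncyl Ns)) orbF => /eqP.
Qed.

(** [T] and [q] are unit vectors of the Euclidean plane orthogonal to [dq], and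
developability makes them collinear there. *)
Lemma tangent_developable (N : ruled_surface R) s :
  spacelike_surface N -> developable N -> curve_dom (striction N) s ->
  let e := '<tangent (striction N) s, ruling N s>_L in
  tangent (striction N) s = e *: ruling N s /\ e ^+ 2 = 1.
Proof.
move=> sN dN Ns /=.
apply: (@unit_orthogonal_collinear _ _ _ (derive1 (ruling N) s)).
- exact: spacelike_dq_timelike.
- exact: striction_orth.
- apply: (unit_field_derive_orthogonal (I := curve_dom (striction N))) => //.
  + exact: curve_dom_open.
  + by move=> t; exact: ruling_unit.
  + by have [] := ruling_C1 Ns.
- exact: developable_det3.
- exact: curve_arc_length.
- exact: ruling_unit.
Qed.

End Developable.

(** * Matching tangents and rulings *)

Section CoOriented.
Context {R : realType}.

(** The two signs relating tangents to rulings have square 1 and, by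
co-orientation, a positive product: they are equal. *)
Lemma co_oriented_tangent (Na Nb : ruled_surface R) s t :
  spacelike_surface Na -> spacelike_surface Nb ->
  developable Na -> developable Nb -> co_oriented Na Nb ->
  curve_dom (striction Na) s -> curve_dom (striction Nb) t ->
  exists2 e : R, e != 0 &
    tangent (striction Na) s = e *: ruling Na s /\
    tangent (striction Nb) t = e *: ruling Nb t.
Proof.
move=> sa sb da db ori As Bt; have := ori _ _ As Bt.
have [] := tangent_developable sa da As.
have [] := tangent_developable sb db Bt.
set ea := '<tangent (striction Na) s, _>_L.
set eb := '<tangent (striction Nb) t, _>_L.
move=> Tb eb2 Ta ea2 eab.
have eq_e : eb = ea.
  have /eqP : eb ^+ 2 = ea ^+ 2 by rewrite eb2.
  rewrite eqf_sqr => /orP[/eqP//|/eqP eN].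
  by move: eab; rewrite eN mulrN -expr2 ea2 ltr0N1.
exists ea; last by rewrite -{2}eq_e.
by rewrite -sqrf_eq0 ea2 oner_eq0.
Qed.

Lemma co_oriented_rulings_agreeP (Na Nb : ruled_surface R) s t :
  spacelike_surface Na -> spacelike_surface Nb ->
  developable Na -> developable Nb -> co_oriented Na Nb ->
  curve_dom (striction Na) s -> curve_dom (striction Nb) t ->
  ruling Na s = ruling Nb t <->
  tangent (striction Na) s = tangent (striction Nb) t.
Proof.
move=> sa sb da db ori As Bt.
have [e e0 [-> ->]] := co_oriented_tangent sa sb da db ori As Bt.
by split=> [->//|]; exact: scalerI.
Qed.

End CoOriented.

Theorem theorem5p4 (R : realType) (Na Nb : ruled_surface R)
    (spacelike_a : spacelike_surface Na) (spacelike_b : spacelike_surface Nb)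
    (dev_a : developable Na) (dev_b : developable Nb)
    (orient : co_oriented Na Nb) :
  spacelike_similar_ruled Na Nb <->
  similar_curves (striction Na) (striction Nb).
Proof.
have agreeP s t := @co_oriented_rulings_agreeP _ _ _ s t
  spacelike_a spacelike_b dev_a dev_b orient.
split=> [[_ _ [lam [phi [vt qab]]]]|[lam [phi [vt Tab]]]].
- exists lam, phi; split=> // t Bt; have [[phiI _ _] _ _ _] := vt.
  by apply/agreeP => //; [exact: phiI|exact: qab].
- split=> //; exists lam, phi; split=> // t Bt; have [[phiI _ _] _ _ _] := vt.
  by apply/agreeP => //; [exact: phiI|exact: Tab].
Qed.
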